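(* Let $a<b$ be real, $\Omega=(a,b)$, let $\Omega_0=(a_0,b_0)$ with $a<a_0<b_0<b$, and let $1\le p\le4$. Let $(\epsilon_n)$ be positive reals with $\epsilon_n\to0^+$, and let $u_n\in W^{2,p}(\Omega)$ satisfy $$\sup_n\int_\Omega\epsilon_n^{-1}(u_n^2-1)^2+\epsilon_n^3|u_n''|^2\,dx<\infty.$$ Then there is a universal constant $C'>0$ such that $$\int_{\Omega_0}\epsilon_n|u_n'|^2\,dx\le C'\int_\Omega\epsilon_n^{-1}(u_n^2-1)^2+\epsilon_n^3|u_n''|^2\,dx$$ for all sufficiently large $n$. *)

(* Defs.v *)
From HB Require Import structures.
From mathcomp Require Import all_boot all_order all_algebra.
From mathcomp Require Import all_classical all_reals all_analysis.
Set Implicit Arguments. Unset Strict Implicit. Unset Printing Implicit Defensive.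
Import Order.TTheory GRing.Theory Num.Theory.
Import numFieldNormedType.Exports.
Local Open Scope classical_set_scope.
Local Open Scope ring_scope.

Section Sobolev.
Variable R : realType.

Definition intI (a b : R) (f : R -> R) : \bar R :=
  (\int[@lebesgue_measure R]_(x in `]a, b[) (f x)%:E)%E.

Definition inLp (a b p : R) (f : R -> R) : Prop :=
  measurable_fun `]a, b[ f /\ (intI a b (fun x => powR `|f x| p) < +oo)%E.

Definition test_fun (a b : R) (phi : R -> R) : Prop :=
  (forall (k : nat) (x : R), derivable (derive1n k phi) x 1) /\
  exists c d : R, a < c /\ d < b /\
    (forall x : R, (x < c \/ d < x) -> phi x = 0).

Definition weak_deriv (a b : R) (u v : R -> R) : Prop :=
  forall phi : R -> R, test_fun a b phi ->
    intI a b (fun x => u x * (derive1 phi) x) = oppe (intI a b (fun x => v x * phi x)).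

Definition W2p (a b p : R) (u du ddu : R -> R) : Prop :=
  [/\ inLp a b p u, inLp a b p du, inLp a b p ddu,
      weak_deriv a b u du & weak_deriv a b du ddu].

Definition energy (a b eps : R) (u ddu : R -> R) : \bar R :=
  intI a b (fun x => eps^-1 * (u x ^+ 2 - 1) ^+ 2 + eps ^+ 3 * `|ddu x| ^+ 2).

End Sobolev.

(* Main.v *)
Require Import Defs.
From HB Require Import structures.
From mathcomp Require Import all_boot all_order all_algebra.
From mathcomp Require Import all_classical all_reals all_analysis.
From mathcomp Require Import measurable_realfun ring lra.
Import Order.TTheory GRing.Theory Num.Theory.
Import numFieldNormedType.Exports.
Local Open Scope classical_set_scope.
Local Open Scope ring_scope.

(* On an interval J of length e, put H = int_J |u''|. Then |u'| oscillates by at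
   most H on J, and (e H)^2 <= e^3 int_J |u''|^2 by Cauchy-Schwarz. At a point s
   with |u'(s)| <= 2 H this bounds e^2 u'(s)^2 by the energy on J. Otherwise
   |u'| >= |u'(s)| / 2 on J, so u moves with at least that speed and spends at
   most half of the length of J within |u'(s)| e / 32 of 1 or of -1; off that set
   |u^2 - 1| >= |u'(s)| e / 32, so the potential term alone bounds e^2 u'(s)^2.
   Integrating over s in J and summing over consecutive intervals of length
   e = eps_n, starting at a0, gives the claim as soon as eps_n < b - b0. The weak
   derivatives are turned into pointwise increments at Lebesgue points. *)

(** * Smooth transition functions and bounds on their derivatives *)

Section SmoothStep.
Variable R : realType.
Implicit Types (f g : R -> R) (x : R).

(** [flat 0] is the classical smooth function that vanishes to infinite order at 0. The extra powers
    [x ^- n] make the family stable under differentiation, up to linear combinations. *)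
Definition flat (n : nat) x : R := if 0 < x then x ^- n * expR (- x^-1) else 0.

Lemma flat_ge0 n x : 0 <= flat n x.
Proof.
rewrite /flat; case: ltP => // x0.
by rewrite mulr_ge0 ?expR_ge0// invr_ge0 exprn_ge0// ltW.
Qed.

Lemma flat_le0 n x : x <= 0 -> flat n x = 0.
Proof. by move=> x0; rewrite /flat ltNge x0. Qed.

Lemma flat_gt0 n x : 0 < x -> 0 < flat n x.
Proof.
by move=> x0; rewrite /flat x0 mulr_gt0 ?expR_gt0// invr_gt0 exprn_gt0.
Qed.

(** Keeping the term of degree [n.+1] in the series of [expR x^-1] beats the factor [x ^- n] by one
    power of [x]. The resulting linear bound gives differentiability at 0. *)
Lemma flat_le n x : flat n x <= n.+1`!%:R * `|x|.
Proof.
have [x0|x0] := leP x 0; first by rewrite flat_le0// mulr_ge0.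
rewrite /flat x0 gtr0_norm// expRN.
have xV0 : 0 <= x^-1 by rewrite invr_ge0 ltW.
have h : x ^- n.+1 / n.+1`!%:R <= expR x^-1.
  rewrite -exprVn; apply: le_trans (expR_ge1Dxn n xV0).
  by rewrite lerDr.
have F0 : 0 < n.+1`!%:R :> R by rewrite ltr0n fact_gt0.
rewrite ler_pdivrMr ?expR_gt0//.
apply: le_trans (ler_wpM2l _ h); last by rewrite mulr_ge0// ltW.
rewrite exprS invfM -exprVn le_eqVlt; apply/orP; left; apply/eqP.
by field; rewrite gt_eqF//= gt_eqF.
Qed.

Lemma flat_is_derive n x :
  is_derive x 1 (flat n) (flat n.+2 x - n%:R * flat n.+1 x).
Proof.
have [x0|x0|->] := ltgtP x 0.
- rewrite !flat_le0 ?ltW// mulr0 subr0.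
  apply: (@near_eq_is_derive _ _ _ (cst 0)).
  near=> y; rewrite flat_le0//; near: y.
  by exists (- x) => /=; [rewrite oppr_gt0|move=> y /=; rewrite ltr_norml => /andP[]; lra].
- rewrite /flat x0.
  have xn : x != 0 by rewrite gt_eqF.
  have dV : is_derive x 1 (fun y : R => y^-1) (- x ^- 2).
    by apply: is_derive_eq (is_deriveV xn (is_derive_id x 1)) _; rewrite scaler1.
  have dE : is_derive x 1 (expR \o (fun y : R => - y^-1)) (expR (- x^-1) * x ^- 2).
    apply: is_derive1_comp; apply: is_derive_eq (is_deriveN dV) _.
    by rewrite opprK.
  have dF := is_deriveM (is_deriveX n dV) dE.
  have eqF : \forall y \near x, ((fun y : R => y^-1) ^+ n * (expR \o (fun y : R => - y^-1))) y = flat n y.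
    near=> y; rewrite /flat ifT ?fctE ?exprVn//; near: y.
    exists x => //= y /=; rewrite ltr_norml => /andP[]; lra.
  apply: is_derive_eq (near_eq_is_derive eqF dF) _.
  rewrite /GRing.scale/= fctE -!exprVn !exprS.
  case: n {dF eqF} => [|n] /=; first by rewrite !expr0; ring.
  rewrite !exprS; ring.
- rewrite !flat_le0// mulr0 subr0.
  have H : h^-1 *: ((flat n \o shift 0) (h *: 1) - flat n 0) @[h --> (0:R)^'] --> (0:R).
    apply/cvgr0Pnorm_le => e e0.
    have F0 : 0 < n.+2`!%:R :> R by rewrite ltr0n fact_gt0.
    near=> h.
    rewrite /= addr0 [flat n 0]flat_le0// subr0 scaler1 /GRing.scale/=.
    (* The difference quotient at 0 is again a member of the family, so [flat_le] makes it tend to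
       0. *)
    have -> : h^-1 * flat n h = flat n.+1 h.
      by rewrite /flat; case: ifP => h0; rewrite ?mulr0// exprS invfM mulrA.
    rewrite ger0_norm ?flat_ge0//; apply: le_trans (flat_le _ _) _.
    rewrite mulrC -ler_pdivlMr//.
    near: h; apply: nbhs_dnbhs; exists (e / n.+2`!%:R) => /=; first by rewrite divr_gt0.
    by move=> h /=; rewrite sub0r normrN => /ltW.
  apply: DeriveDef; first by apply/cvg_ex; exists 0.
  exact: cvg_lim H.
Unshelve. all: by end_near. Qed.

(* A class closed under differentiation, hence made of smooth functions. *)
Inductive elementary : (R -> R) -> Prop :=
| elem_cst c : elementary (fun=> c)
| elem_flat n a c : elementary (fun x => flat n (a * x + c))
| elem_add f g : elementary f -> elementary g -> elementary (fun x => f x + g x)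
| elem_mul f g : elementary f -> elementary g -> elementary (fun x => f x * g x)
| elem_inv f : elementary f -> (forall x, f x != 0) -> elementary (fun x => (f x)^-1).

Lemma elementary_is_derive f : elementary f ->
  exists2 f', elementary f' & forall x, is_derive x 1 f (f' x).
Proof.
elim=> [c|n a c|{}f g _ [f' ef' df] _ [g' eg' dg]|{}f g ef [f' ef' df] eg [g' eg' dg]|{}f ef [f' ef' df] f0].
- exists (fun=> 0); first exact: elem_cst.
  by move=> x; exact: is_derive_cst.
- exists (fun x => (flat n.+2 (a * x + c) + (- n%:R) * flat n.+1 (a * x + c)) * a).
    by do ![exact: elem_cst | exact: elem_flat | apply: elem_mul | apply: elem_add].
  move=> x; rewrite mulNr.
  have d : is_derive x 1 (fun y : R => a * y + c) a.
    have da := is_deriveZ a (is_derive_id x (1 : R)).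
    apply: is_derive_eq (is_deriveD da (is_derive_cst (c : R^o) x 1)) _.
    by rewrite addr0 /GRing.scale/= mulr1.
  exact: (@is_derive1_comp _ (flat n) (fun y => a * y + c) x _ _ (flat_is_derive n (a * x + c)) d).
- exists (fun x => f' x + g' x); first exact: elem_add.
  by move=> x; exact: is_deriveD.
- exists (fun x => f x * g' x + g x * f' x); first by apply: elem_add; exact: elem_mul.
  by move=> x; exact: is_deriveM.
- exists (fun x => (-1 * ((f x)^-1 * (f x)^-1)) * f' x).
    by do ![exact: elem_cst | assumption | apply: elem_mul | apply: elem_inv].
  move=> x; apply: is_derive_eq (is_deriveV (f0 x) (df x)) _.
  by rewrite /GRing.scale/= -exprVn mulN1r expr2.
Qed.

Lemma elementary_derive1n f k : elementary f -> elementary (derive1n k f).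
Proof.
move=> ef; elim: k => // k ih; rewrite derive1nS.
have [g eg dg] := elementary_is_derive _ ih.
suff -> : derive1 (derive1n k f) = g by [].
by apply/funext => x; rewrite derive1E; have dgx := dg x; rewrite derive_val.
Qed.

Lemma elementary_derivable f k x : elementary f -> derivable (derive1n k f) x 1.
Proof.
move=> /(elementary_derive1n _ k) /elementary_is_derive[g _ /(_ x) dg].
exact: ex_derive.
Qed.

(* A smooth transition from 0 on [x <= s] to 1 on [s + d <= x]. *)
Definition step (s d x : R) : R :=
  flat 0 (d^-1 * x + - (s / d)) *
    (flat 0 (d^-1 * x + - (s / d)) + flat 0 (- d^-1 * x + (s / d + 1)))^-1.

(** The two arguments of [flat 0] in the denominator add up to 1, so one of them is positive and the
    denominator never vanishes. *)
Lemma step_elementary s d : elementary (step s d).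
Proof.
apply: elem_mul; first exact: elem_flat.
apply: elem_inv; first by apply: elem_add; exact: elem_flat.
move=> x; rewrite mulNr; set y := d^-1 * x.
rewrite gt_eqF//; have [h|h] := ltP 0 (y - s / d).
  by rewrite ltr_wpDr ?flat_ge0 ?flat_gt0.
by rewrite ltr_wpDl ?flat_ge0 ?flat_gt0//; lra.
Qed.

Lemma step_bounds s d x : 0 <= step s d x <= 1.
Proof.
rewrite /step; set A := flat 0 _; set B := flat 0 (- _ * _ + _).
have A0 : 0 <= A by exact: flat_ge0.
have B0 : 0 <= B by exact: flat_ge0.
rewrite divr_ge0 ?addr_ge0//=.
have [->|An0] := eqVneq A 0; first by rewrite mul0r.
by rewrite ler_pdivrMr ?mul1r ?lerDl// ltr_wpDr// lt0r An0.
Qed.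

Lemma step_left s d x : 0 < d -> x <= s -> step s d x = 0.
Proof.
move=> d0 xs; rewrite /step flat_le0 ?mul0r// mulrC subr_le0.
by rewrite ler_pM2r// invr_gt0.
Qed.

Lemma step_right s d x : 0 < d -> s + d <= x -> step s d x = 1.
Proof.
move=> d0 xs; rewrite /step; have h : (s + d) / d <= x / d.
  by rewrite ler_pM2r// invr_gt0.
move: h; rewrite mulrDl divff ?gt_eqF// => h.
rewrite [X in _ / (_ + X)]flat_le0.
  rewrite addr0 divff// gt_eqF// flat_gt0//; rewrite mulrC; lra.
rewrite mulrC mulrN; lra.
Qed.

(** All transitions are rescalings of one profile, so a single constant controls their
    derivatives. *)
Lemma step_scale s d x : 0 < d -> step s d x = step 0 1 ((x - s) / d).
Proof.
move=> d0; rewrite /step !mul0r invr1 mul1r oppr0 addr0 mulN1r add0r.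
by congr (flat _ _ / (flat _ _ + flat _ _)); field; rewrite gt_eqF.
Qed.

Lemma step_test_fun (a b s t d : R) : 0 < d -> a < s -> s < t -> t + d < b ->
  test_fun a b (fun x => step s d x - step t d x).
Proof.
move=> d0 as_ st tb; split.
  move=> k x; apply: elementary_derivable.
  have -> : (fun x => step s d x - step t d x) = (fun x => step s d x + -1 * step t d x).
    by apply/funext => y; rewrite mulN1r.
  apply: elem_add; first exact: step_elementary.
  apply: elem_mul; [exact: elem_cst|exact: step_elementary].
exists s, (t + d); split=> //; split=> // x [xs|tx].
  by rewrite !step_left ?subrr// ltW// (lt_trans xs).
rewrite !step_right ?subrr//; lra.
Qed.

Lemma step_derive s d x : 0 < d -> derivable (step s d) x 1 /\
  derive1 (step s d) x = d^-1 * derive1 (step 0 1) ((x - s) / d).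
Proof.
move=> d0; split; first exact: (elementary_derivable _ 0%N _ (step_elementary _ _)).
rewrite (_ : step s d = step 0 1 \o (fun x => (x - s) / d)); last first.
  by apply/funext => y; rewrite step_scale.
have d2 : is_derive x 1 (fun y : R => (y - s) / d) d^-1.
  have ds := is_deriveB (is_derive_id x (1 : R)) (is_derive_cst s x 1).
  apply: is_derive_eq (is_deriveM ds (is_derive_cst d^-1 x 1)) _.
  by rewrite /= scaler0 add0r subr0 /GRing.scale/= mulr1.
have d1 : is_derive ((x - s) / d) 1 (step 0 1) (derive1 (step 0 1) ((x - s) / d)).
  rewrite derive1E; apply/derivableP.
  exact: (elementary_derivable _ 0%N _ (step_elementary _ _)).
have dc := @is_derive1_comp _ (step 0 1) (fun y => (y - s) / d) x _ _ d1 d2.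
by rewrite derive1E derive_val mulrC.
Qed.

Lemma step_derive_continuous s d : continuous (derive1 (step s d)).
Proof.
move=> x; apply: differentiable_continuous; apply/derivable1_diffP.
exact: (elementary_derivable _ 1%N _ (step_elementary _ _)).
Qed.

Lemma step_derive_out s d x : 0 < d -> x \notin `[s, s + d] ->
  derive1 (step s d) x = 0.
Proof.
move=> d0; rewrite in_itv/= negb_and -!ltNge derive1E => /orP[xs|sx].
  have h : is_derive x 1 (step s d) 0.
    apply: (@near_eq_is_derive _ _ _ (cst 0)).
    near=> z; rewrite step_left//; near: z.
    exists (s - x) => /=; [by rewrite subr_gt0|move=> z /=; rewrite ltr_norml => /andP[]; lra].
  by rewrite derive_val.
have h : is_derive x 1 (step s d) 0.
  apply: (@near_eq_is_derive _ _ _ (cst (1 : R^o))).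
  near=> z; rewrite step_right//; near: z.
  exists (x - (s + d)) => /=; [by rewrite subr_gt0|move=> z /=; rewrite ltr_norml => /andP[]; lra].
by rewrite derive_val.
Unshelve. all: by end_near. Qed.

(** The derivative of the profile [step 0 1] is continuous and vanishes off [[0, 1]], hence is
    bounded; rescaling produces the factor [d^-1]. *)
Lemma step_derive_bounded : exists2 K : R, 0 < K & forall s d x, 0 < d ->
  `|derive1 (step s d) x| <= K / d.
Proof.
have [|c _ cmax] := @EVT_max R (fun x => `|derive1 (step 0 1) x|) 0 1 ler01.
  apply: continuous_subspaceT => x; apply: continuous_comp.
    exact: step_derive_continuous.
  exact: norm_continuous.
(* Adding 1 makes [K] positive at no cost. *)
exists (`|derive1 (step 0 1) c| + 1); first by rewrite ltr_wpDl.
move=> s d x d0; have [_ ->] := step_derive s d x d0.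
rewrite normrM mulrC [`|d^-1|]gtr0_norm ?invr_gt0// ler_pM2r ?invr_gt0//.
set y := (x - s) / d.
have [/andP[y0 y1]|yn] := boolP (0 <= y <= 1).
  by apply: le_trans (cmax y _) _; rewrite ?in_itv/= ?y0 ?lerDl.
suff -> : derive1 (step 0 1) y = 0 by rewrite normr0 addr_ge0.
by rewrite step_derive_out// in_itv/= add0r.
Qed.

(** With support in [[s, s + d]] and the bound [K / d], unit mass makes these derivatives an
    approximate identity at [s], from the right. *)
Lemma integral_step_derive s d : 0 < d ->
  (\int[lebesgue_measure]_(x in `[s, (s + d)%R]) (derive1 (step s d) x)%:E = 1)%E.
Proof.
move=> d0; have ssd : s < s + d by rewrite ltrDl.
rewrite (@continuous_FTC2 _ _ (step s d) _ _ ssd).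
- by rewrite step_right// step_left// sube0.
- by apply: continuous_subspaceT; exact: step_derive_continuous.
- have cs : continuous (step s d).
    move=> x; apply: differentiable_continuous; apply/derivable1_diffP.
    exact: (elementary_derivable _ 0%N _ (step_elementary _ _)).
  split.
  + by move=> x _; exact: (elementary_derivable _ 0%N _ (step_elementary _ _)).
  + by apply: cvg_at_right_filter; exact: cs.
  + by apply: cvg_at_left_filter; exact: cs.
- by [].
Qed.

End SmoothStep.

(** * From weak derivatives to increments between Lebesgue points *)

Section WeakDerivative.
Variable R : realType.
Implicit Types (f g h : R -> R) (a b s t x : R).
Notation mu := (@lebesgue_measure R).

Lemma integrable_mul_bounded (D : set R) g h (M : R) : measurable D ->
  mu.-integrable D (EFin \o g) -> measurable_fun D h ->
  (forall x, D x -> `|h x| <= M) -> mu.-integrable D (EFin \o (fun x => g x * h x)).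
Proof.
move=> mD ig mh hM.
apply: (@integrableMl _ _ _ mu _ mD (EFin \o g) h ig mh).
exists M; split; first exact: num_real.
by move=> K MK x Dx; apply: le_trans (hM x Dx) (ltW MK).
Qed.

Lemma integrable_sub (D : set R) g h : measurable D ->
  mu.-integrable D (EFin \o g) -> mu.-integrable D (EFin \o h) ->
  mu.-integrable D (EFin \o (fun x => g x - h x)).
Proof. by move=> mD ig ih; exact: (@integrableB _ _ _ mu _ mD _ _ ig ih). Qed.

(** Transfers an exact identity between four approximants [x1], ..., [x4] to their limits, each
    approximation costing [e / 4]. *)
Lemma sub_dist_le4 (x1 x2 x3 x4 y1 y2 y3 y4 e : R) :
  `|x1 - y1| <= e / 4 -> `|x2 - y2| <= e / 4 ->
  `|x3 - y3| <= e / 4 -> `|x4 - y4| <= e / 4 ->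
  x3 - x4 = - (x1 - x2) -> `|y4 - y3 - (y1 - y2)| <= e.
Proof. by rewrite !ler_norml; lra. Qed.

Lemma step_measurable s d (D : set R) : measurable D -> measurable_fun D (step R s d).
Proof.
move=> mD; apply: measurable_funTS; apply: continuous_measurable_fun => x.
apply: differentiable_continuous; apply/derivable1_diffP.
exact: (elementary_derivable _ _ 0%N _ (step_elementary _ _ _)).
Qed.

Lemma step_derive_measurable s d (D : set R) : measurable D ->
  measurable_fun D (derive1 (step R s d)).
Proof.
move=> mD; apply: measurable_funTS; apply: continuous_measurable_fun.
exact: step_derive_continuous.
Qed.

Lemma measurable_ltr_indic s (D : set R) : measurable D ->
  measurable_fun D (fun x : R => (s < x)%R%:R : R).
Proof.
move=> mD; have -> : (fun x : R => (s < x)%R%:R : R) = \1_(`]s, +oo[).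
  apply/funext => x; rewrite indicE; congr (nat_of_bool _)%:R.
  by apply/idP/idP; rewrite inE/= in_itv/= andbT.
exact: measurable_indic.
Qed.

(** [step s d] differs from the indicator of [s < x] only on [[s, s + d]], and by at most 1. The
    error is thus at most the integral of [|h|] over that interval, small by absolute continuity of
    the integral. *)
Lemma integral_step_cvg a b h s : mu.-integrable `]a, b[ (EFin \o h) -> a < s ->
  forall e : R, 0 < e -> \forall d \near 0^'+,
  `|\int[mu]_(x in `]a, b[) (h x * step R s d x) - \int[mu]_(x in `]a, b[) (h x * (s < x)%R%:R)| <= e.
Proof.
move=> ih as_ e e0.
have mI : measurable (`]a, b[ : set R) by [].
have ihT : mu.-integrable setT (EFin \o (h \_ `]a, b[)).
  by rewrite -restrict_EFin; apply/integrable_restrict => //; rewrite setTI.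
have [d0 [d00 hd0]] := integral_normr_continuous ihT e0.
have mlt := measurable_ltr_indic s `]a, b[ mI.
near=> d.
have d_gt0 : 0 < d by near: d; exact: nbhs_right_gt.
have dd0 : d < d0 by near: d; exact: nbhs_right_lt.
have i1 : mu.-integrable `]a, b[ (EFin \o (fun x => h x * step R s d x)).
  apply: (@integrable_mul_bounded _ _ _ 1) => //; first exact: step_measurable.
  by move=> x _; have /andP[x0 x1] := step_bounds R s d x; rewrite ger0_norm.
have i2 : mu.-integrable `]a, b[ (EFin \o (fun x => h x * (s < x)%R%:R)).
  apply: (@integrable_mul_bounded _ _ _ 1) => // x _.
  by case: (s < x); rewrite ?normr1 ?normr0.
rewrite -RintegralB//.
have hsd : \int[mu]_(x in `[s, (s + d)%R]) `|(h \_ `]a, b[) x| < e.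
  apply: hd0; first exact: (measurable_itv `[s, s + d]).
  change (mu `[s, (s + d)%R] < d0%:E)%E.
  by rewrite lebesgue_measure_itv/= lte_fin ltrDl d_gt0 -EFinB lte_fin addrC addKr.
apply: le_trans _ (ltW hsd).
have i3 := integrable_sub _ _ _ mI i1 i2.
apply: le_trans (le_normr_Rintegral _ i3) _ => //.
(* Both integrands are extended by zero to the whole line, where they can be compared pointwise
   although their domains differ. *)
rewrite Rintegral_mkcond [leRHS]Rintegral_mkcond.
apply: le_Rintegral => //.
- rewrite -restrict_EFin; apply/integrable_restrict => //; rewrite setTI.
  exact: (integrable_norm i3).
- rewrite -restrict_EFin; apply/integrable_restrict => //; rewrite setTI.
  apply: integrableS (integrable_norm ihT) => //.
- move=> x _; rewrite !patchE.
  case: ifPn => [xab|xab]; last by case: ifP => _; rewrite ?normr0.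
  rewrite -mulrBr normrM.
  case: ifPn => xsd.
    apply: ler_piMr => //; have /andP[x0 x1] := step_bounds R s d x.
    by case: (s < x) => /=; rewrite ler_norml; lra.
  have [sx|xs] := ltP s x; last by rewrite step_left// subrr normr0 mulr0.
  rewrite step_right ?subrr ?normr0 ?mulr0//.
  move: xsd; apply: contraNT; rewrite -ltNge inE/= in_itv/= (ltW sx) => /ltW -> //.
Unshelve. all: by end_near. Qed.

(** By unit mass, [g s] is itself an integral against the derivative of [step s d]. The difference
    is at most [K / d] times the integral of [|g - g s|] over [[s, s + d]], which tends to 0 at a
    Lebesgue point. *)
Lemma integral_step_derive_cvg a b g s : mu.-integrable `]a, b[ (EFin \o g) ->
  a < s < b -> lebesgue_pt (g \_ `]a, b[) s ->
  forall e : R, 0 < e -> \forall d \near 0^'+,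
  `|\int[mu]_(x in `]a, b[) (g x * derive1 (step R s d) x) - g s| <= e.
Proof.
move=> ig /andP[as_ sb] ps e e0.
have mI : measurable (`]a, b[ : set R) by [].
have [K K0 hK] := step_derive_bounded R.
pose G := g \_ `]a, b[.
have Gs : G s = g s by rewrite /G patchE mem_set//= in_itv/= as_ sb.
have e' : 0 < e / (4 * K) by rewrite divr_gt0// mulr_gt0.
have pse : \forall d \near 0^'+, (davg G s d < (e / (4 * K))%:E)%E.
  have := ps => /fine_cvgP[fp] /cvgr0Pnorm_lt /(_ _ e') cp.
  near=> d.
  have fd : davg G s d \is a fin_num by near: d; exact: fp.
  rewrite -(fineK fd) lte_fin; apply: le_lt_trans (ler_norm _) _.
  by near: d.
(* Balls are open, so [[s, s + d]] is placed in the ball of radius [2 * d]. Its length [4 * d]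
   against the bound [K / d] explains the tolerance [e / (4 * K)]. *)
have pse2 : \forall d \near 0^'+, (davg G s (2 * d) < (e / (4 * K))%:E)%E.
  case: pse => r r0 hr.
  exists (r / 2) => /=; first by rewrite divr_gt0.
  move=> d /= dr d0; apply: hr => /=; last by rewrite mulr_gt0.
  by move: dr; rewrite !sub0r !normrN normrM gtr0_norm// ltr_pdivlMr// mulrC.
near=> d.
have d0 : 0 < d by near: d; exact: nbhs_right_gt.
have sdb : s + d < b.
  by rewrite -ltrBrDl; near: d; apply: nbhs_right_lt; rewrite subr_gt0.
have hd : (davg G s (2 * d) < (e / (4 * K))%:E)%E by near: d.
have JI : `[s, s + d] `<=` `]a, b[.
  by apply: subset_itv => //; rewrite bnd_simp.
have igJ : mu.-integrable `[s, s + d] (EFin \o g) by apply: integrableS ig.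
have i1 : mu.-integrable `[s, s + d] (EFin \o (fun x => g x * derive1 (step R s d) x)).
  apply: (@integrable_mul_bounded _ _ _ (K / d)) => //; first exact: step_derive_measurable.
  by move=> x _; exact: hK.
have icst c : mu.-integrable `[s, s + d] (EFin \o cst c).
  apply: measurable_bounded_integrable => //.
    by rewrite /= lebesgue_measure_itv/= lte_fin ltrDl d0 -EFinB ltry.
  by exists `|c|; split; [exact: num_real|move=> M cM x _; exact: ltW].
have i2 : mu.-integrable `[s, s + d] (EFin \o (fun x => g s * derive1 (step R s d) x)).
  apply: (@integrable_mul_bounded _ _ _ (K / d)) => //.
  - exact: icst.
  - exact: step_derive_measurable.
  - by move=> x _; exact: hK.
have i2' : mu.-integrable `[s, s + d] (EFin \o (derive1 (step R s d))).
  have := (@integrable_mul_bounded _ (cst 1) (derive1 (step R s d)) (K / d)) _ (icst 1).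
  move=> /(_ (measurable_itv _) (step_derive_measurable _ _ _ (measurable_itv _)) (fun x _ => hK s d x d0)).
  by congr (_ .-integrable _ _); apply/funext => x /=; rewrite mul1r.
have -> : \int[mu]_(x in `]a, b[) (g x * derive1 (step R s d) x) =
          \int[mu]_(x in `[s, s + d]) (g x * derive1 (step R s d) x).
  rewrite Rintegral_mkcond [RHS]Rintegral_mkcond; apply: eq_Rintegral => x _.
  rewrite !patchE; case: ifPn => [xab|xab].
    case: ifPn => [//|xJ]; rewrite step_derive_out ?mulr0//.
    by apply: contra xJ => xJ; rewrite inE.
  case: ifPn => // xJ; exfalso; move: xab => /negP; apply.
  by rewrite inE; apply: JI; rewrite inE in xJ.
have -> : g s = \int[mu]_(x in `[s, s + d]) (g s * derive1 (step R s d) x).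
  by rewrite RintegralZl// /Rintegral integral_step_derive//= mulr1.
rewrite -RintegralB//.
have i3 := integrable_sub _ _ _ (measurable_itv _) i1 i2.
apply: le_trans (le_normr_Rintegral _ i3) _ => //.
rewrite -lee_fin.
have i4 := integrable_norm i3.
rewrite [X in (X <= _)%E]fineK; last exact: (integrable_fin_num _ i4).
have mG : measurable_fun setT G.
  apply/(measurable_restrictT _ _).1 => //.
  by have /measurable_int/measurable_EFinP := ig.
apply: (@le_trans _ _ (\int[mu]_(x in `[s, (s + d)%R]) ((K / d)%:E * `|(G x - G s)%:E|))%E).
  apply: ge0_le_integral => //.
  - exact: (measurable_int mu i4).
  - apply: measurable_funeM; apply: measurableT_comp => //.
    by apply/measurable_EFinP; apply: measurable_funTS; apply: measurable_funB.
  - move=> x xJ; rewrite -EFinM lee_fin -mulrBl normrM mulrC.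
    rewrite Gs /G patchE mem_set; last exact: JI.
    by apply: ler_wpM2r => //; exact: hK.
rewrite ge0_integralZl//; last 2 first.
- apply: measurableT_comp => //.
  by apply/measurable_EFinP; apply: measurable_funTS; apply: measurable_funB.
- by rewrite lee_fin divr_ge0// ltW.
move: hd; rewrite /davg /iavg lebesgue_measure_ball; last by rewrite mulr_ge0// ltW.
set D := (\int[mu]_(y in ball s (2 * d)) _)%E.
have D0 : (0 <= D)%E by exact: integral_ge0.
have DJ : (\int[mu]_(x in `[s, (s + d)%R]) `|(G x - G s)%:E| <= D)%E.
  apply: ge0_subset_integral => //.
  - exact: measurable_ball.
  - apply: measurableT_comp => //; apply/measurable_EFinP.
    by apply: measurable_funTS; apply: measurable_funB.
  - by rewrite ball_itv; apply: subset_itv; rewrite bnd_simp; lra.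
move=> hd; apply: (@le_trans _ _ ((K / d)%:E * D)%E).
  by apply: lee_wpmul2l => //; rewrite lee_fin divr_ge0// ltW.
move: hd; have [->|Dn0] := eqVneq D 0%E; first by rewrite !mule0 lee_fin ltW.
rewrite inver mulrn_eq0/= mulf_eq0 !gt_eqF//=.
(* An infinite integral over the ball is excluded by [hd]. *)
move: D0 {DJ}; case: D Dn0 => [D||]//; last first.
  by rewrite mulry gtr0_sg ?mul1e ?invr_gt0 ?mulrn_wgt0 ?mulr_gt0.
move=> Dn0 D0; rewrite -!EFinM lte_fin lee_fin.
have d4 : 0 < 2 * d *+ 2 by rewrite mulrn_wgt0// mulr_gt0.
move=> /ltW; rewrite mulrC ler_pdivrMr// => h.
apply: le_trans (ler_wpM2l _ h) _; first by rewrite divr_ge0// ltW.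
rewrite le_eqVlt; apply/orP; left; apply/eqP.
by rewrite -mulr_natr; field; rewrite !gt_eqF.
Unshelve. all: by end_near. Qed.

(* The test functions [step s d - step t d] tend to the indicator of [`]s, t]], and
   integrating [g] against their derivatives averages [g] near [s] and near [t]. *)
Lemma weak_deriv_FTC a b g h s t :
  mu.-integrable `]a, b[ (EFin \o g) -> mu.-integrable `]a, b[ (EFin \o h) ->
  weak_deriv a b g h -> a < s -> s < t -> t < b ->
  lebesgue_pt (g \_ `]a, b[) s -> lebesgue_pt (g \_ `]a, b[) t ->
  g t - g s = \int[mu]_(x in `]s, t]) h x.
Proof.
move=> ig ih w as_ st tb ps pt.
have sb := lt_trans st tb; have at_ := lt_trans as_ st.
have mI : measurable (`]a, b[ : set R) by [].
have [K K0 hK] := step_derive_bounded R.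
pose A r := \int[mu]_(x in `]a, b[) (h x * (r < x)%R%:R).
have mlt r := measurable_ltr_indic r `]a, b[ mI.
have iA r : mu.-integrable `]a, b[ (EFin \o (fun x => h x * (r < x)%R%:R)).
  apply: (@integrable_mul_bounded _ _ _ 1) => // x _.
  by case: (r < x); rewrite ?normr1 ?normr0.
have -> : \int[mu]_(x in `]s, t]) h x = A s - A t.
  rewrite /A -RintegralB// Rintegral_mkcond [RHS]Rintegral_mkcond.
  apply: eq_Rintegral => x _; rewrite !patchE -mulrBr.
  case: ifPn => [|xst].
    rewrite inE/= in_itv/= => /andP[sx xt].
    rewrite mem_set/= ?in_itv/= ?(lt_trans as_ sx) ?(le_lt_trans xt)//.
    by rewrite sx ltNge xt subr0 mulr1.
  case: ifP => // _.
  have [sx|xs] := ltP s x; have [tx|xt] := ltP t x; rewrite ?subrr ?mulr0//.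
    by move: xst; rewrite notin_setE/= in_itv/= sx xt.
  by have := lt_le_trans (lt_trans st tx) xs; rewrite ltxx.
apply/eqP; rewrite -subr_eq0 -normr_le0; apply/ler_addgt0Pl => e e0.
rewrite addr0.
have e4 : 0 < e / 4 by rewrite divr_gt0.
near (0 : R)^'+ => d.
have d0 : 0 < d by near: d; exact: nbhs_right_gt.
have tdb : t + d < b.
  by rewrite -ltrBrDl; near: d; apply: nbhs_right_lt; rewrite subr_gt0.
have h1 : `|\int[mu]_(x in `]a, b[) (h x * step R s d x) - A s| <= e / 4.
  by near: d; apply: integral_step_cvg.
have h2 : `|\int[mu]_(x in `]a, b[) (h x * step R t d x) - A t| <= e / 4.
  by near: d; apply: integral_step_cvg.
have h3 : `|\int[mu]_(x in `]a, b[) (g x * derive1 (step R s d) x) - g s| <= e / 4.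
  by near: d; apply: integral_step_derive_cvg => //; rewrite as_ sb.
have h4 : `|\int[mu]_(x in `]a, b[) (g x * derive1 (step R t d) x) - g t| <= e / 4.
  by near: d; apply: integral_step_derive_cvg => //; rewrite at_ tb.
have i1 r : mu.-integrable `]a, b[ (EFin \o (fun x => h x * step R r d x)).
  apply: (@integrable_mul_bounded _ _ _ 1) => //; first exact: step_measurable.
  by move=> x _; have /andP[x0 x1] := step_bounds R r d x; rewrite ger0_norm.
have i2 r : mu.-integrable `]a, b[ (EFin \o (fun x => g x * derive1 (step R r d) x)).
  apply: (@integrable_mul_bounded _ _ _ (K / d)) => //; first exact: step_derive_measurable.
  by move=> x _; exact: hK.
have := w _ (step_test_fun R a b s t d d0 as_ st tdb).
have E1 : intI a b (fun x => g x * derive1 (fun y => step R s d y - step R t d y) x) =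
   (\int[mu]_(x in `]a, b[) (g x * derive1 (step R s d) x) -
    \int[mu]_(x in `]a, b[) (g x * derive1 (step R t d) x))%:E.
  rewrite -RintegralB// /Rintegral fineK; last first.
    exact: (integrable_fin_num _ (integrable_sub _ _ _ mI (i2 s) (i2 t))).
  apply: eq_integral => x _; congr EFin; rewrite -mulrBr; congr (_ * _).
  rewrite !derive1E.
  have [/derivableP ds _] := step_derive R s d x d0.
  have [/derivableP dt _] := step_derive R t d x d0.
  by have dst := is_deriveB ds dt; rewrite derive_val.
have E2 : intI a b (fun x => h x * (step R s d x - step R t d x)) =
   (\int[mu]_(x in `]a, b[) (h x * step R s d x) -
    \int[mu]_(x in `]a, b[) (h x * step R t d x))%:E.
  rewrite -RintegralB// /Rintegral fineK; last first.
    exact: (integrable_fin_num _ (integrable_sub _ _ _ mI (i1 s) (i1 t))).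
  by apply: eq_integral => x _; congr EFin; rewrite -mulrBr.
rewrite E1 E2 -EFinN => -[E].
exact: sub_dist_le4 h1 h2 h3 h4 E.
Unshelve. all: by end_near. Qed.

End WeakDerivative.

(** * The gradient estimate on one interval of length [e] *)

Section LocalEstimate.
Variable R : realType.
Implicit Types (u v w : R -> R).
Notation mu := (@lebesgue_measure R).

Lemma ae_mono (P Q : R -> Prop) : (forall x, P x -> Q x) ->
  {ae mu, forall x, P x} -> {ae mu, forall x, Q x}.
Proof.
move=> PQ; apply: negligibleS => x /= nQ Px; apply: nQ; exact: PQ.
Qed.

Definition density (e : R) u w (x : R) : R :=
  e^-1 * (u x ^+ 2 - 1) ^+ 2 + e ^+ 3 * `|w x| ^+ 2.

Lemma density_ge0 e u w x : 0 < e -> 0 <= density e u w x.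
Proof.
move=> e0; rewrite addr_ge0// mulr_ge0 ?sqr_ge0//; first by rewrite invr_ge0 ltW.
by rewrite exprn_ge0// ltW.
Qed.

Lemma measurable_density e u w (D : set R) : measurable_fun D u ->
  measurable_fun D w -> measurable_fun D (density e u w).
Proof.
move=> mu_ mw; rewrite /density.
apply: measurable_funD; apply: measurable_funM => //.
  by apply: measurable_funX; apply: measurable_funB => //; apply: measurable_funX.
by apply: measurable_funX; apply: measurableT_comp.
Qed.

(** For [1 <= p] one has [|f| <= 1 + |f| ^ p], and constants are integrable on a bounded
    interval. *)
Lemma inLp_integrable a b p (f : R -> R) : 1 <= p -> inLp a b p f ->
  mu.-integrable `]a, b[ (EFin \o f).
Proof.
move=> p1 [mf foo].
have mp : measurable_fun `]a, b[ (fun x => powR `|f x| p).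
  apply: (measurableT_comp (measurable_powR p)).
  exact: measurableT_comp.
apply/integrableP; split; first exact/measurable_EFinP.
have : (\int[mu]_(x in `]a, b[) (1 + powR `|f x| p)%:E < +oo)%E.
  under eq_integral do rewrite EFinD.
  rewrite ge0_integralD//; last exact/measurable_EFinP.
  rewrite lte_add_pinfty// integral_cst// mul1e.
  change (mu `]a, b[ < +oo)%E.
  by rewrite lebesgue_measure_itv/=; case: ifP => _; rewrite ?ltry// -EFinB ltry.
apply: le_lt_trans; apply: ge0_le_integral => //.
- by apply: measurableT_comp => //; exact/measurable_EFinP.
- by apply/measurable_EFinP; apply: measurable_funD.
- move=> x _ /=; rewrite lee_fin.
  have [f1|/ltW f1] := leP `|f x| 1; first by rewrite (le_trans f1)// lerDl powR_ge0.
  by rewrite -[leLHS]powRr1// (le_trans (ler_powR f1 p1))// lerDr.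
Qed.

(** One of the factors [y - 1] and [y + 1], selected by the sign of [y], has absolute value at least
    1. *)
Lemma norm_sqrB1_ge (y r : R) : r <= `|y - 1| -> r <= `|y + 1| -> r <= `|y ^+ 2 - 1|.
Proof.
have -> : y ^+ 2 - 1 = (y - 1) * (y + 1) by ring.
rewrite normrM => r1 r2.
have [y0|y0] := leP 0 y.
  apply: le_trans r1 _; rewrite ler_peMr//.
  by rewrite ler_normr; apply/orP; left; lra.
apply: le_trans r2 _; rewrite ler_peMl//.
by rewrite ler_normr; apply/orP; right; lra.
Qed.

Lemma norm_ge_half (x y k : R) : `|x - y| <= k -> k * 2 <= `|y| -> k <= `|x|.
Proof.
have := ler_normD (y - x) x; rewrite subrK distrC => h1 h2 h3; lra.
Qed.

(** Here [v] and [w] stand for the first and second weak derivatives of [u], and [good] for the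
    common Lebesgue points of [u] and [v]. The interval [J] is half-open so that its translates by
    multiples of [e] tile the line. *)
Variables (c e : R) (u v w : R -> R) (good : R -> Prop).
Hypotheses (e0 : 0 < e).
Let J : set R := `[c, (c + e)%R[%classic.
Hypotheses (mu_ : measurable_fun J u).
Hypotheses (iv : mu.-integrable J (EFin \o v)) (iw : mu.-integrable J (EFin \o w)).
Hypotheses (aegood : {ae mu, forall x, J x -> good x}).
Hypotheses (vw : forall s t, J s -> J t -> good s -> good t -> s < t ->
  v t - v s = \int[mu]_(x in `]s, t]) w x).
Hypotheses (uv : forall s t, J s -> J t -> good s -> good t -> s < t ->
  u t - u s = \int[mu]_(x in `]s, t]) v x).

Let mJ : measurable J. Proof. exact: measurable_itv. Qed.
Let muJ : mu J = e%:E.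
Proof. by rewrite lebesgue_measure_itv/= lte_fin ltrDl e0 -EFinB addrC addKr. Qed.
Let sJ s t : J s -> J t -> `]s, t] `<=` J.
Proof.
rewrite /J/= !in_itv/= => /andP[cs _] /andP[_ te] x /=; rewrite !in_itv/= => /andP[sx xt].
by rewrite (le_trans cs (ltW sx)) (le_lt_trans xt te).
Qed.
Let mv : measurable_fun J v. Proof. by have /measurable_int/measurable_EFinP := iv. Qed.
Let mw : measurable_fun J w. Proof. by have /measurable_int/measurable_EFinP := iw. Qed.
Let H := \int[mu]_(x in J) `|w x|.
Let Q : \bar R := (\int[mu]_(x in J) (density e u w x)%:E)%E.
Let mdens : measurable_fun J (density e u w). Proof. exact: measurable_density. Qed.

Let H0 : 0 <= H. Proof. exact: Rintegral_ge0. Qed.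
Let HE : (\int[mu]_(x in J) `|w x|%:E)%E = H%:E.
Proof. by rewrite /H /Rintegral fineK//; exact: (integrable_fin_num _ (integrable_norm iw)). Qed.

Lemma osc_le s t : J s -> J t -> good s -> good t -> `|v t - v s| <= H.
Proof.
wlog st : s t / s < t.
  move=> wl Js Jt gs gt; have [st|ts|->] := ltgtP s t.
  - exact: wl.
  - by rewrite distrC; exact: wl.
  - by rewrite subrr normr0.
move=> Js Jt gs gt; rewrite vw//.
have sub := sJ s t Js Jt.
have iw' : mu.-integrable `]s, t] (EFin \o w) by apply: integrableS iw.
apply: le_trans (le_normr_Rintegral _ iw') _ => //.
rewrite -lee_fin /H -/H -HE.
rewrite [X in (X <= _)%E]fineK; last exact: (integrable_fin_num _ (integrable_norm iw')).
apply: ge0_subset_integral => //.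
by apply/measurable_EFinP; apply: measurableT_comp.
Qed.

Lemma osc_sqr_le : (((e * H) ^+ 2)%:E <= Q)%E.
Proof.
(* integrates [2 l |w| <= w ^ 2 + l ^ 2] with [l = H / e] *)
have p0 : (0 <= e ^+ 3 * (2 * (H / e))) by rewrite !mulr_ge0// ?exprn_ge0 ?invr_ge0// ltW.
have h : ((e ^+ 3 * (2 * (H / e)))%:E * H%:E <= Q + (e ^+ 3 * (H / e) ^+ 2)%:E * e%:E)%E.
  rewrite -muJ -integral_cst// -HE -ge0_integralZl//; last first.
    by apply/measurable_EFinP; apply: measurableT_comp.
  rewrite -ge0_integralD//=; last 3 first.
  - by move=> x _; rewrite lee_fin density_ge0.
  - exact/measurable_EFinP.
  - by move=> x _; rewrite lee_fin mulr_ge0 ?sqr_ge0// exprn_ge0// ltW.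
  apply: ge0_le_integral => //=.
  - by move=> x _; rewrite mule_ge0// lee_fin.
  - apply: measurable_funeM; apply/measurable_EFinP; exact: measurableT_comp.
  - by apply/measurable_EFinP; apply: measurable_funD.
  - move=> x _; rewrite -EFinM -EFinD lee_fin /density -addrA -mulrDr -mulrA.
    apply: ler_wpDl; first by rewrite mulr_ge0 ?sqr_ge0// invr_ge0 ltW.
    rewrite ler_wpM2l ?(exprn_ge0 _ (ltW e0))//.
    rewrite -subr_ge0 [leRHS](_ : _ = (`|w x| - H / e) ^+ 2) ?sqr_ge0//; ring.
move: h; case: Q => [q||].
- rewrite -!EFinM -EFinD !lee_fin => h.
  have E1 : e ^+ 3 * (2 * (H / e)) * H = 2 * (e * H) ^+ 2 by field; rewrite gt_eqF.
  have E2 : e ^+ 3 * (H / e) ^+ 2 * e = (e * H) ^+ 2 by field; rewrite gt_eqF.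
  by move: h; rewrite E1 E2; lra.
- by move=> _; rewrite leey.
- by rewrite -!EFinM addNye leeNy_eq.
Qed.

(** By [osc_le], [v] stays within [|v s| / 2] of the constant [v s] at every good point of [J],
    hence almost everywhere. Integrating, [u y - u x] differs from [v s * (y - x)] by at most half
    of the size of the latter. *)
Lemma slope_ge s x y : J s -> good s -> 2 * H < `|v s| ->
  J x -> J y -> good x -> good y -> `|v s| / 2 * `|y - x| <= `|u y - u x|.
Proof.
move=> Js gs HM; wlog xy : x y / x < y.
  move=> wl Jx Jy gx gy; have [xy|yx|->] := ltgtP x y.
  - exact: wl.
  - by rewrite distrC [leRHS]distrC; exact: wl.
  - by rewrite !subrr normr0 mulr0.
move=> Jx Jy gx gy; rewrite uv//.
have sub := sJ x y Jx Jy.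
have iv' : mu.-integrable `]x, y] (EFin \o v) by apply: integrableS iv.
have muxy : mu `]x, y] = (y - x)%:E by rewrite lebesgue_measure_itv/= lte_fin xy -EFinB.
have ic : mu.-integrable `]x, y] (EFin \o cst (v s)).
  apply: measurable_bounded_integrable => //.
    by change (mu `]x, y] < +oo)%E; rewrite muxy ltry.
  by exists `|v s|; split; [exact: num_real|move=> M cM z _; exact: ltW].
have xy0 : 0 < y - x by rewrite subr_gt0.
rewrite (gtr0_norm xy0).
have Ec : \int[mu]_(z in `]x, y]) (cst (v s) z) = v s * (y - x).
  by rewrite Rintegral_cst//; congr (_ * _); rewrite [LHS](_ : _ = fine (mu `]x, y]))// muxy.
have id := integrable_sub _ _ _ _ (measurable_itv `]x, y]) iv' ic.
have D : `|\int[mu]_(z in `]x, y]) v z - v s * (y - x)| <= `|v s| / 2 * (y - x).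
  rewrite -Ec -RintegralB//.
  apply: le_trans (le_normr_Rintegral _ id) _ => //.
  rewrite -lee_fin.
  rewrite [X in (X <= _)%E]fineK; last exact: (integrable_fin_num _ (integrable_norm id)).
  rewrite EFinM -muxy -integral_cst//.
  apply: ae_ge0_le_integral => //.
  - exact: (measurable_int mu (integrable_norm id)).
  - by move=> z _; rewrite lee_fin divr_ge0.
  - apply: (ae_mono _ _ _ aegood) => z gz xyz; rewrite lee_fin /=.
    have Jz := sub _ xyz.
    apply: le_trans (osc_le s z Js Jz gs (gz Jz)) _.
    by rewrite ler_pdivlMr// mulrC ltW.
apply: norm_ge_half D _.
by rewrite normrM (gtr0_norm xy0) mulrAC divfK.
Qed.

(** Take for [z] any good point of the set. At another such point [x] the values of [u] differ by
    less than [|v s| * e / 16], and the slope bound [|v s| / 2] turns this into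
    [|x - z| < e / 8]. *)
Lemma level_set_sub s (l : R) : J s -> good s -> 2 * H < `|v s| ->
  exists z, forall x, J x -> good x -> `|u x - l| < `|v s| * e / 32 ->
    z - e / 8 <= x <= z + e / 8.
Proof.
move=> Js gs HM.
have M0 : 0 < `|v s| by apply: le_lt_trans HM; rewrite mulr_ge0.
have [[z [Jz gz hz]]|nz] := pselect (exists z, [/\ J z, good z & `|u z - l| < `|v s| * e / 32]).
  exists z => x Jx gx hx.
  have := slope_ge s z x Js gs HM Jz Jx gz gx => h.
  have h2 : `|u x - u z| < `|v s| * e / 16.
    have -> : u x - u z = (u x - l) - (u z - l) by ring.
    apply: le_lt_trans (ler_normB _ _) _.
    lra.
  have h3 : `|x - z| < e / 8.
    rewrite -(ltr_pM2l M0); lra.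
  by move: h3; rewrite ltr_norml => /andP[p q]; apply/andP; split; lra.
(* The set is empty, so any center will do. *)
by exists 0 => x Jx gx hx; exfalso; apply: nz; exists x.
Qed.

(** Removing from [J] one interval of length [e / 4] for each of the levels 1 and -1 leaves measure
    at least [e / 2]. At the good points left, [norm_sqrB1_ge] bounds the potential term below by
    [e^-1 * r ^+ 2], with [r = |v s| * e / 32]. *)
Lemma steep_bound s : J s -> good s -> 2 * H < `|v s| ->
  ((v s ^+ 2 * e ^+ 2)%:E <= 2048%:E * Q)%E.
Proof.
move=> Js gs HM.
have [z1 h1] := level_set_sub s 1 Js gs HM.
have [z2 h2] := level_set_sub s (-1) Js gs HM.
pose I1 : set R := `[z1 - e / 8, z1 + e / 8]%classic.
pose I2 : set R := `[z2 - e / 8, z2 + e / 8]%classic.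
have mI1 : measurable I1 by exact: measurable_itv.
have mI2 : measurable I2 by exact: measurable_itv.
have mA : measurable (J `\` (I1 `|` I2)).
  by apply: measurableD => //; apply: measurableU.
have muI z : mu `[(z - e / 8)%R, (z + e / 8)%R] = (e / 4)%:E.
  rewrite lebesgue_measure_itv/= lte_fin ifT; last by move: e0; lra.
  by rewrite -EFinB; congr EFin; field.
have muA : ((e / 2)%:E <= mu (J `\` (I1 `|` I2)))%E.
  have : (mu J <= mu (J `\` (I1 `|` I2)) + (mu I1 + mu I2))%E.
    apply: (@le_trans _ _ (mu ((J `\` (I1 `|` I2)) `|` (I1 `|` I2)))).
      apply: le_measure; rewrite ?inE//.
        by apply: measurableU => //; apply: measurableU.
      by move=> x Jx; have [?|?] := pselect ((I1 `|` I2) x); [right|left].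
    apply: le_trans (measureU2 _ _ _) _ => //; first exact: measurableU.
    by rewrite leeD2l// measureU2.
  rewrite muJ !muI -EFinD; case: (mu _) => [m||]//.
  - by rewrite -EFinD !lee_fin; lra.
  - by move=> _; rewrite leey.
set r := `|v s| * e / 32.
have r0 : 0 <= r by rewrite /r !mulr_ge0// ltW.
have : ((e^-1 * r ^+ 2)%:E * mu (J `\` (I1 `|` I2)) <= Q)%E.
  apply: (@le_trans _ _ (\int[mu]_(x in J `\` (I1 `|` I2)) (density e u w x)%:E)%E); last first.
    apply: ge0_subset_integral => //.
    - exact/measurable_EFinP.
    - by move=> x _; rewrite lee_fin density_ge0.
  rewrite -integral_cst//.
  apply: ae_ge0_le_integral => //.
  - by move=> x _; rewrite lee_fin mulr_ge0 ?sqr_ge0// invr_ge0 ltW.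
  - by move=> x _; rewrite lee_fin density_ge0.
  - by apply/measurable_EFinP; apply: measurable_funS mdens => //; exact: subDsetl.
  - apply: (ae_mono _ _ _ aegood) => x gx [Jx nI]; rewrite lee_fin /density.
    have {}gx := gx Jx.
    apply: ler_wpDr; first by rewrite mulr_ge0 ?sqr_ge0// exprn_ge0// ltW.
    rewrite ler_wpM2l ?invr_ge0 ?(ltW e0)//.
    rewrite -[leRHS]real_normK ?num_real//.
    rewrite lerXn2r ?nnegrE//.
    apply: norm_sqrB1_ge.
      by rewrite leNgt; apply/negP => hx; apply: nI; left; rewrite /I1/= in_itv/=; exact: h1.
    by rewrite leNgt; apply/negP => hx; apply: nI; right; rewrite /I2/= in_itv/=; apply: h2 => //; rewrite opprK.
move=> hQ.
have hQ2 : ((e^-1 * r ^+ 2)%:E * (e / 2)%:E <= Q)%E.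
  apply: le_trans _ hQ; apply: lee_wpmul2l => //.
  by rewrite lee_fin mulr_ge0 ?sqr_ge0// invr_ge0 ltW.
(* The constant is [2 * 32 ^ 2 = 2048]: 32 comes from [r] and 2 from the remaining half of [J]. *)
have -> : ((v s ^+ 2 * e ^+ 2)%:E = 2048%:E * ((e^-1 * r ^+ 2)%:E * (e / 2)%:E))%E.
  rewrite -!EFinM; congr EFin; rewrite /r -[v s ^+ 2]real_normK ?num_real//.
  by field; rewrite gt_eqF.
by rewrite lee_wpmul2l ?lee_fin ?ler0n.
Qed.

Lemma pointwise_bound s : J s -> good s ->
  ((v s ^+ 2 * e ^+ 2)%:E <= 2048%:E * Q)%E.
Proof.
move=> Js gs; have [HM|HM] := ltP (2 * H) `|v s|; first exact: steep_bound.
(* When [|v s| <= 2 * H], [osc_sqr_le] gives the constant 4, which is then enlarged to 2048. *)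
apply: (@le_trans _ _ (4%:E * ((e * H) ^+ 2)%:E)%E).
  rewrite -EFinM lee_fin -[v s ^+ 2]real_normK ?num_real//.
  have -> : 4 * (e * H) ^+ 2 = (2 * H) ^+ 2 * e ^+ 2 by ring.
  by rewrite ler_wpM2r ?sqr_ge0// lerXn2r ?nnegrE ?mulr_ge0.
apply: le_trans (lee_wpmul2l _ osc_sqr_le) _ => //.
apply: lee_wpmul2r; last by rewrite lee_fin ler_nat.
by apply: integral_ge0 => x _; rewrite lee_fin density_ge0.
Qed.

(** [pointwise_bound] bounds the integrand by [e^-1 * 2048 * Q], which does not depend on the point;
    integration over the length [e] cancels [e^-1]. *)
Lemma local_estimate :
  (\int[mu]_(x in J) (e * `|v x| ^+ 2)%:E <= 2048%:E * Q)%E.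
Proof.
have Q0 : (0 <= Q)%E by apply: integral_ge0 => x _; rewrite lee_fin density_ge0.
have := pointwise_bound; have : 0 < 2048 :> R by rewrite ltr0n.
(* From here on only the positivity of the constant matters. *)
move: (2048 : R) => C C0 pb.
have [Qoo|Qoo] := eqVneq Q +oo%E; first by rewrite Qoo gt0_muley ?leey ?lte_fin.
have fQ : Q \is a fin_num by rewrite ge0_fin_numE// ltey.
have -> : (C%:E * Q = (e^-1 * (C * fine Q))%:E * mu J)%E.
  by rewrite muJ -EFinM mulrAC mulVf ?gt_eqF// mul1r EFinM fineK.
rewrite -integral_cst//.
apply: ae_ge0_le_integral => //.
- by move=> x _; rewrite lee_fin mulr_ge0 ?sqr_ge0// ltW.
- apply/measurable_EFinP; apply: measurable_funM => //.
  by apply: measurable_funX; apply: measurableT_comp.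
- by move=> x _; rewrite lee_fin !mulr_ge0 ?invr_ge0 ?fine_ge0// ltW.
- apply: (ae_mono _ _ _ aegood) => x gx Jx; rewrite lee_fin.
  have := pb x Jx (gx Jx); rewrite -(fineK fQ) -EFinM lee_fin => h.
  rewrite ler_pdivlMl// real_normK ?num_real//.
  by apply: le_trans h; rewrite le_eqVlt; apply/orP; left; apply/eqP; ring.
Qed.

End LocalEstimate.

(** * Summation over consecutive intervals and the global estimate *)

Section Covering.
Variable R : realType.
Notation mu := (@lebesgue_measure R).

(** Induction on the number of intervals: both integrals are additive over disjoint half-open
    pieces, so the constant [C] does not grow with [n]. *)
Lemma integral_le_of_steps (a b c e C : R) (f g : R -> R) : 0 < e ->
  measurable_fun `]a, b[ f -> measurable_fun `]a, b[ g ->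
  (forall x, 0 <= f x) -> (forall x, 0 <= g x) -> 0 <= C -> a < c ->
  (forall s, a < s -> s + e < b ->
    (\int[mu]_(x in `[s, (s + e)%R[) (f x)%:E <=
     C%:E * \int[mu]_(x in `[s, (s + e)%R[) (g x)%:E)%E) ->
  forall n, c + n%:R * e < b ->
    (\int[mu]_(x in `[c, (c + n%:R * e)%R[) (f x)%:E <=
     C%:E * \int[mu]_(x in `[c, (c + n%:R * e)%R[) (g x)%:E)%E.
Proof.
move=> e0 mf mg f0 g0 C0 ac loc; elim=> [|n IH] cnb.
  by rewrite mul0r addr0 set_itvco0 !integral_set0 mule0.
set m := c + n%:R * e.
have E : c + n.+1%:R * e = m + e by rewrite /m -natr1 mulrDl mul1r addrA.
have cm : c <= m by rewrite lerDl mulr_ge0// ltW.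
have mb : m + e < b by rewrite -E.
have mb' : m < b by apply: lt_trans mb; rewrite ltrDl.
have U : `[c, m + e[%classic = `[c, m[%classic `|` `[m, m + e[%classic.
  by rewrite -itv_bndbnd_setU// bnd_simp// lerDl ltW.
have S : `[c, m + e[%classic `<=` `]a, b[%classic.
  by apply: subset_itv; rewrite bnd_simp// ltW.
have split_int (h : R -> R) : measurable_fun `]a, b[ h -> (forall x, 0 <= h x) ->
   (\int[mu]_(x in `[c, (m + e)%R[) (h x)%:E = \int[mu]_(x in `[c, m[) (h x)%:E +
     \int[mu]_(x in `[m, (m + e)%R[) (h x)%:E)%E.
  move=> mh h0; rewrite U ge0_integral_setU//.
  - apply/measurable_EFinP; apply: measurable_funS mh => //.
    by rewrite -U.
  - by move=> x _; rewrite lee_fin.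
  - apply/disj_setPS => x [/=]; rewrite !in_itv/= => /andP[_ xm] /andP[mx _].
    by have := lt_le_trans xm mx; rewrite ltxx.
rewrite E !split_int//.
rewrite ge0_muleDr; [|by apply: integral_ge0 => x _; rewrite lee_fin..].
apply: leeD; first exact: IH.
by apply: loc => //; exact: lt_le_trans cm.
Qed.

(** Take one more than the integer part of [(b0 - a0) / e]: the grid then passes [b0] by at most
    [e], which is less than [b - b0]. *)
Lemma grid_exists (a0 b0 b e : R) : 0 < e -> a0 < b0 -> e < b - b0 ->
  exists n : nat, b0 <= a0 + n%:R * e < b.
Proof.
move=> e0 ab eb.
have q0 : 0 <= (b0 - a0) / e by rewrite divr_ge0 ?ltW// subr_gt0.
have /andP[] := truncn_itv q0; set n := Num.Def.trunc _.
rewrite ler_pdivlMr// ltr_pdivrMr// => h1 h2; exists n.+1.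
have E : n.+1%:R * e = n%:R * e + e by rewrite -natr1 mulrDl mul1r.
by move: h2; rewrite E => h2; apply/andP; split; lra.
Qed.

Lemma gradient_estimate (a b a0 b0 p e : R) (u du ddu : R -> R) :
  a < a0 -> a0 < b0 -> 1 <= p -> 0 < e -> e < b - b0 ->
  W2p a b p u du ddu ->
  (intI a0 b0 (fun x => (e * `|du x| ^+ 2)%R) <= 2048%:E * energy a b e u ddu)%E.
Proof.
move=> aa0 ab0 p1 e0 eb [Lu Ldu Lddu wu wdu].
have b0b : b0 < b by move: e0 eb; lra.
have iu := inLp_integrable _ _ _ _ _ p1 Lu.
have idu := inLp_integrable _ _ _ _ _ p1 Ldu.
have iddu := inLp_integrable _ _ _ _ _ p1 Lddu.
have mI : measurable (`]a, b[ : set R) by [].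
(* Increments of both [u] and [du] are used, while [ddu] enters only under integrals. Cutting off
   outside []a, b[] makes the functions locally integrable on the line, so almost every point is
   good. *)
pose good x := lebesgue_pt (u \_ `]a, b[) x /\ lebesgue_pt (du \_ `]a, b[) x.
have aeg : {ae mu, forall x, good x}.
  have h1 := lebesgue_differentiation (integrable_locally mI iu).
  have h2 := lebesgue_differentiation (integrable_locally mI idu).
  by apply: negligibleS (negligibleU h1 h2); rewrite -setCI.
have C0 : 0 <= 2048 :> R by rewrite ler0n.
have loc s : a < s -> s + e < b ->
    (\int[mu]_(x in `[s, (s + e)%R[) (e * `|du x| ^+ 2)%:E <=
     2048%:E * \int[mu]_(x in `[s, (s + e)%R[) (density R e u ddu x)%:E)%E.
  move=> as_ sb.
  have S : `[s, s + e[%classic `<=` `]a, b[%classic.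
    by apply: subset_itv; rewrite bnd_simp// ltW.
  have ft g h (ig : mu.-integrable `]a, b[ (EFin \o g))
      (ih : mu.-integrable `]a, b[ (EFin \o h)) x y :
      weak_deriv a b g h -> `[s, s + e[%classic x -> `[s, s + e[%classic y ->
      lebesgue_pt (g \_ `]a, b[) x -> lebesgue_pt (g \_ `]a, b[) y -> x < y ->
      g y - g x = \int[mu]_(z in `]x, y]) h z.
    move=> w Jx Jy px py xy.
    have /andP[ax _] : a < x < b by have := S _ Jx; rewrite /= in_itv.
    have /andP[_ yb] : a < y < b by have := S _ Jy; rewrite /= in_itv.
    exact: weak_deriv_FTC ig ih w ax xy yb px py.
  apply: (@local_estimate R s e u du ddu good e0).
  - by apply: measurable_funS S _ => //; case: Lu.
  - by apply: integrableS idu.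
  - by apply: integrableS iddu.
  - by apply: (ae_mono _ _ _ _ aeg) => x gx _.
  - by move=> x y Jx Jy [_ px] [_ py] xy; apply: (ft _ _ idu iddu).
  - by move=> x y Jx Jy [px _] [py _] xy; apply: (ft _ _ iu idu).
have mf : measurable_fun `]a, b[ (fun x => e * `|du x| ^+ 2).
  apply: measurable_funM => //; apply: measurable_funX; apply: measurableT_comp => //.
  by case: Ldu.
have mg : measurable_fun `]a, b[ (density R e u ddu).
  by apply: measurable_density; [case: Lu|case: Lddu].
have f0 x : 0 <= e * `|du x| ^+ 2 by rewrite mulr_ge0 ?sqr_ge0// ltW.
have g0 x : 0 <= density R e u ddu x by exact: density_ge0.
have [n /andP[bn nb]] := grid_exists a0 b0 b e e0 ab0 eb.
move: C0 loc; move: (2048 : R) => C C0 loc.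
have := integral_le_of_steps a b a0 e C _ _ e0 mf mg f0 g0 C0 aa0 loc n nb.
have S : `[a0, a0 + n%:R * e[%classic `<=` `]a, b[%classic.
  by apply: subset_itv; rewrite bnd_simp// ltW.
(* Both integrands are nonnegative, and the union of the grid intervals contains []a0, b0[] and lies
   in []a, b[]. *)
move=> h; apply: le_trans (le_trans h _).
  apply: ge0_subset_integral => //.
  - by apply/measurable_EFinP; apply: measurable_funS S mf.
  - by move=> x _; rewrite lee_fin.
  - by apply: subset_itv; rewrite bnd_simp.
apply: lee_wpmul2l; first by rewrite lee_fin.
apply: ge0_subset_integral => //.
- exact/measurable_EFinP.
- by move=> x _; rewrite lee_fin; exact: g0.
Qed.

End Covering.

Theorem theorem3p2 (R : realType) :
  exists C' : R, 0 < C' /\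
  forall (a b a0 b0 p : R) (eps : nat -> R) (u du ddu : nat -> R -> R),
    a < a0 -> a0 < b0 -> b0 < b ->
    1 <= p -> p <= 4 ->
    (forall n, 0 < eps n) -> eps @ \oo --> 0 ->
    (forall n, W2p a b p (u n) (du n) (ddu n)) ->
    (exists M : R, forall n, (energy a b (eps n) (u n) (ddu n) <= M%:E)%E) ->
    \forall n \near \oo,
      lee (intI a0 b0 (fun x => eps n * `|du n x| ^+ 2))
          (mule C'%:E (energy a b (eps n) (u n) (ddu n))).
Proof.
exists 2048; split; first by rewrite ltr0n.
move=> a b a0 b0 p eps u du ddu aa0 ab0 b0b p1 _ eps0 epsc W _.
have bb : 0 < b - b0 by rewrite subr_gt0.
near=> n.
apply: gradient_estimate (W n) => //.
(* It remains to have [eps n < b - b0], the room that the last grid interval needs beyond [b0]. *)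
near: n; move/cvgrPdist_lt : epsc => /(_ _ bb).
by apply: filterS => n; rewrite sub0r normrN gtr0_norm.
Unshelve. all: by end_near. Qed.
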